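(* Let $\{\xi_1,\xi_2,\ldots\}$ be independent real-valued random variables such that, for some constants $a>0$, $b\in\mathbb{N}$, $c>0$, $\varepsilon\geqslant 0$, $h>0$, $d_1\geqslant 1$ and $d_2\geqslant 1$: (i) $\displaystyle \frac1n\sum_{i=1}^n \mathbb{E}\,\xi_i\leqslant -a$ for all $n\geqslant b$; (ii) $\displaystyle \sup_{n\geqslant b}\frac1n\sum_{i=1}^n \mathbb{E}\big(|\xi_i|\mathbf{1}_{\{\xi_i\leqslant -c\}}\big)\leqslant \varepsilon$; (iii) $\displaystyle \sup_{n\geqslant b}\frac1n\sum_{i=1}^n \Big(\mathbb{P}(\xi_i\leqslant 0)+\mathbb{E}\big(e^{h\xi_i}\mathbf{1}_{\{\xi_i>0\}}\big)\Big)\leqslant d_1$; (iv) $\displaystyle \max_{1\leqslant n\leqslant b-1}\frac1n\sum_{i=1}^n \Big(\mathbb{P}(\xi_i\leqslant 0)+\mathbb{E}\big(e^{h\xi_i}\mathbf{1}_{\{\xi_i>0\}}\big)\Big)\leqslant d_2$. If, for some $\delta\in(0,1/2]$, $$-\Delta:=\varepsilon+\delta h d_1\max\Big\{\frac{c^2}{2},\frac{2}{h^2}\Big\}-a<0,$$ then $$\mathbb{P}\Big(\sup_{n\geqslant 0}\sum_{i=1}^n\xi_i>x\Big)\leqslant \min\big\{1,\,c_1 e^{-\delta h x}\big\},\qquad x\geqslant 0,$$ where $$c_1=S(b,d_2)+\frac{\exp\{-\delta h\Delta b\}}{1-\exp\{-\delta h\Delta\}},\qquad S(b,d_2)=\begin{cases}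 d_2\,\dfrac{d_2^{\,b-1}-1}{d_2-1} & \text{if } d_2>1,\\[2mm] b-1 & \text{if } d_2=1.\end{cases}$$
   Context: The random variables are independent but not necessarily identically distributed. $\mathbf{1}_A$ denotes the indicator of the event $A$, and $\mathbb{N}=\{1,2,\ldots\}$. Empty sums are zero (so the $n=0$ term in the supremum equals $0$). When $b=1$, condition (iv) ranges over no $n$ and is vacuous. *)

(* Defs.v *)
From HB Require Import structures.
From mathcomp Require Import all_boot all_order all_algebra.
From mathcomp Require Import all_classical all_reals all_analysis.

Set Implicit Arguments.
Unset Strict Implicit.
Unset Printing Implicit Defensive.

Import Order.TTheory GRing.Theory Num.Theory.
Import numFieldNormedType.Exports.

Local Open Scope classical_set_scope.
Local Open Scope ring_scope.
Local Open Scope ereal_scope.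

(* A sequence xi_1, xi_2, ... is represented by X : nat -> _ with
   xi_(i+1) = X i, so that xi_1 + ... + xi_n is \sum_(i < n) X i. *)

Definition mutually_independent (d : measure_display) (T : measurableType d)
    (R : realType) (P : probability T R) (X : nat -> {RV P >-> R}) : Prop :=
  forall (J : seq nat) (B : nat -> set R),
    uniq J -> (forall i, measurable (B i)) ->
    P (\bigcap_(i in [set` J]) (X i @^-1` B i)) =
    \prod_(i <- J) P (X i @^-1` B i).

(* Expectations are taken in \bar R, hence defined (possibly infinite)
   without an integrability proof. *)

Definition mean_expectation (d : measure_display) (T : measurableType d)
    (R : realType) (P : probability T R) (X : nat -> {RV P >-> R})
    (n : nat) : \bar R :=
  (n%:R^-1)%:E * \sum_(i < n) 'E_P[X i].

Definition mean_lower_tail (d : measure_display) (T : measurableType d)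
    (R : realType) (P : probability T R) (X : nat -> {RV P >-> R})
    (c : R) (n : nat) : \bar R :=
  (n%:R^-1)%:E * \sum_(i < n)
    'E_P[fun w => `|X i w| * \1_[set w' | X i w' <= - c] w]%R.

Definition mean_exp_moment (d : measure_display) (T : measurableType d)
    (R : realType) (P : probability T R) (X : nat -> {RV P >-> R})
    (h : R) (n : nat) : \bar R :=
  (n%:R^-1)%:E * \sum_(i < n)
    (P [set w | X i w <= 0]%R +
     'E_P[fun w => expR (h * X i w) * \1_[set w' | 0 < X i w'] w]%R).

(* Equal to \sum_(1 <= k < b) d2 ^+ k; intended for 1 <= d2, so the else
   branch is the case d2 = 1. *)
Definition geom_const (R : realType) (b : nat) (d2 : R) : R :=
  if (1 < d2)%R then (d2 * ((d2 ^+ (b - 1) - 1) / (d2 - 1)))%R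
  else ((b - 1)%N%:R)%R.

(* n = 0 is included: the empty sum makes the supremum nonnegative. *)
Definition sup_partial_sums (d : measure_display) (T : measurableType d)
    (R : realType) (P : probability T R) (X : nat -> {RV P >-> R})
    (w : T) : \bar R :=
  ereal_sup (range (fun n : nat => (\sum_(i < n) X i w)%R%:E)).

(* Main.v *)
Require Import Defs.
From HB Require Import structures.
From mathcomp Require Import all_boot all_order all_algebra.
From mathcomp Require Import all_classical all_reals all_analysis.
From mathcomp Require Import measurable_realfun ring lra.
Import Order.TTheory GRing.Theory Num.Theory.
Import numFieldNormedType.Exports.
Local Open Scope classical_set_scope.
Local Open Scope ring_scope.

Set Implicit Arguments.
Unset Strict Implicit.
Unset Printing Implicit Defensive.

(** For x >= 0 the event {sup S_n > x} is the union over n >= 1 of {S_n > x},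
so with y = delta * h Markov's inequality for exp (y S_n) and independence bound
its probability by the sum of exp (- y x) * prod_(i <= n) E exp (y xi_i).  By the
AM-GM inequality the product is at most the n-th power of the mean of the
E exp (y xi_i).  For n < b that mean is at most d2, since exp (y r) <= 1 for
r <= 0 and exp (y r) <= exp (h r) for r > 0.  For n >= b the pointwise bound
  exp (y r) <= 1 + y r + y |r| 1_(r <= - c)
               + y^2 max (c^2 / 2, 2 / h^2) (1_(r <= 0) + exp (h r) 1_(r > 0))
shows that it is at most 1 - y Delta <= exp (- y Delta).  The two ranges of n
contribute two geometric sums. *)

(** * Integrals of a weight times a function of a random variable *)

Section weighted_integral.
Context (d : measure_display) (T : measurableType d) (R : realType).
Context (P : {measure set T -> \bar R}).
Local Open Scope ereal_scope.
Import HBNNSimple.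

Lemma integral_indic_comp (X : {mfun T >-> R}) (A : set R) : measurable A ->
  \int[P]_w (\1_A (X w))%:E = P (X @^-1` A).
Proof.
move=> mA; have mXA : measurable (X @^-1` A) by exact: measurable_funPTI.
by rewrite -(setIT (X @^-1` A)) -(integral_indic P measurableT)//.
Qed.

(** The identity extends from indicators to simple functions by linearity, and from those to [g] by
    monotone convergence. In the application [Y] is the product of the factors other than the one in
    [X], and [C] the product of their integrals. *)
Lemma weighted_integral_comp (X : {mfun T >-> R}) (Y : T -> R) (C : R)
    (g : R -> R) :
  measurable_fun setT Y -> (forall w, 0 <= Y w)%R -> (0 <= C)%R ->
  measurable_fun setT g -> (forall r, 0 <= g r)%R ->
  (forall A : set R, measurable A ->
    \int[P]_w (Y w * \1_A (X w))%:E = C%:E * P (X @^-1` A)) ->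
  \int[P]_w (Y w * g (X w))%:E = C%:E * \int[P]_w (g (X w))%:E.
Proof.
move=> mY Y0 C0 mg g0 YA.
have mX : measurable_fun setT X by [].
have nnsfunYA (s : {nnsfun R >-> R}) :
    \int[P]_w (Y w * s (X w))%:E = C%:E * \int[P]_w (s (X w))%:E.
  pose r := finmap.enum_fset (fset_set (range s)).
  pose I y w : R := \1_(s @^-1` [set y]) (X w).
  (* The norm keeps the summands nonnegative for every y : R, as
     ge0_integral_sum requires, and is harmless on the range of s. *)
  have sE w : s (X w) = (\sum_(y <- r) `|y| * I y w)%R.
    rewrite fimfunE fsbig_finite//=; apply: eq_big_seq => y.
    by rewrite in_fset_set// inE => -[u _ <-]; rewrite ger0_norm.
  have ms y : measurable (s @^-1` [set y]) by exact: measurable_funPTI.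
  have mI y : measurable_fun setT (I y).
    by apply: measurableT_comp => //; exact: measurable_indic.
  have I0 y w : (0 <= I y w)%R by [].
  under eq_integral do rewrite sE mulr_sumr -sumEFin.
  under [in RHS]eq_integral do rewrite sE -sumEFin.
  rewrite !ge0_integral_sum//; last 4 first.
  - by move=> y; apply/measurable_EFinP/measurable_funM.
  - by move=> y w _; rewrite lee_fin mulr_ge0.
  - move=> y; apply/measurable_EFinP/measurable_funM => //.
    exact: measurable_funM.
  - by move=> y w _; rewrite lee_fin !mulr_ge0.
  rewrite ge0_sume_distrr; last first.
    by move=> y _; apply: integral_ge0 => w _; rewrite lee_fin mulr_ge0.
  apply: eq_bigr => y _.
  under eq_integral do rewrite mulrCA EFinM.
  rewrite ge0_integralZl_EFin//; last 2 first.
  - by move=> w _; rewrite lee_fin mulr_ge0.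
  - by apply/measurable_EFinP/measurable_funM.
  rewrite YA//.
  under [in RHS]eq_integral do rewrite EFinM.
  rewrite ge0_integralZl_EFin//; last 2 first.
  - by move=> w _; rewrite lee_fin.
  - by apply/measurable_EFinP.
  by rewrite integral_indic_comp// muleCA.
have mg' : measurable_fun setT (EFin \o g) by exact/measurable_EFinP.
pose s := nnsfun_approx measurableT mg'.
have sg x : (s n x)%:E @[n --> \oo] --> (g x)%:E.
  by apply: (@cvg_nnsfun_approx _ _ _ _ measurableT _ mg') => // y _; rewrite lee_fin.
have snd x : {homo s^~ x : m n / (m <= n)%N >-> (m <= n)%R}.
  by move=> m n mn; apply/lefP/nd_nnsfun_approx.
have ms n : measurable_fun setT (fun w => s n (X w)) by exact: measurableT_comp.
(* Monotone convergence for a general weight [Z], since both sides of the goal are limits of this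
   form: [Z = Y] on the left and [Z = 1] on the right. *)
have cv (Z : T -> R) : measurable_fun setT Z -> (forall w, 0 <= Z w)%R ->
    \int[P]_w (Z w * s n (X w))%:E @[n --> \oo] --> \int[P]_w (Z w * g (X w))%:E.
  move=> mZ Z0.
  have -> : \int[P]_w (Z w * g (X w))%:E =
      \int[P]_w limn (fun n => (Z w * s n (X w))%:E).
    apply: eq_integral => w _; apply/esym/cvg_lim => //.
    under eq_fun do rewrite EFinM.
    by rewrite EFinM; apply: cvgeZl.
  apply: cvg_monotone_convergence => //.
  - by move=> n; apply/measurable_EFinP/measurable_funM.
  - by move=> n w _; rewrite lee_fin mulr_ge0.
  - by move=> w _ m n mn; rewrite lee_fin ler_wpM2l// snd.
have /cvg_lim <- // := cv _ mY Y0.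
under eq_fun do rewrite nnsfunYA.
have cvC : C%:E * \int[P]_w (s n (X w))%:E @[n --> \oo] --> C%:E * \int[P]_w (g (X w))%:E.
  apply: cvgeZl => //.
  have := cv (cst 1%R) _ _; under [in X in _ -> _ -> X]eq_integral do rewrite mul1r.
  under [in X in _ -> _ -> X]eq_fun do under eq_integral do rewrite mul1r.
  exact.
exact/cvg_lim.
Qed.

End weighted_integral.

(** * Expectation of a product of independent factors *)

Section independence.
Context (d : measure_display) (T : measurableType d) (R : realType).
Context (P : probability T R) (X : nat -> {RV P >-> R}).
Local Open Scope ereal_scope.

Lemma independent_integral_prod (n : nat) (f : nat -> R -> R) :
  mutually_independent X ->
  (forall i, measurable_fun setT (f i)) -> (forall i r, 0 <= f i r)%R ->
  (forall i, (i < n)%N -> \int[P]_w (f i (X i w))%:E < +oo) ->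
  \int[P]_w (\prod_(i < n) f i (X i w))%:E =
  \prod_(i < n) \int[P]_w (f i (X i w))%:E.
Proof.
move=> indX mf f0 ffin.
(* The functions f i are arbitrary for i < m and indicators for m <= i; the case
   m = 0 is the definition of independence, and m increases by one application
   of weighted_integral_comp to X m. *)
suff H m : (m <= n)%N -> forall f : nat -> R -> R,
  (forall i, measurable_fun setT (f i)) -> (forall i r, 0 <= f i r)%R ->
  (forall i, (i < n)%N -> \int[P]_w (f i (X i w))%:E < +oo) ->
  (forall i, (m <= i)%N -> exists2 A : set R, measurable A & f i = \1_A) ->
  \int[P]_w (\prod_(i < n) f i (X i w))%:E =
  \prod_(i < n) \int[P]_w (f i (X i w))%:E.
  (* Case [m = n]: the functions of index at least [n] do not enter the product, so they may be
     replaced by an indicator, as [H] requires. *)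
  pose f' i := if (i < n)%N then f i else \1_set0.
  have f'E (i : 'I_n) : f' i = f i by rewrite /f' ltn_ord.
  under eq_integral do under eq_bigr do rewrite -f'E.
  under [RHS]eq_bigr do rewrite -f'E.
  apply: (H n) => //.
  - by move=> i; rewrite /f'; case: ifP => // _; exact: measurable_indic.
  - by move=> i r; rewrite /f'; case: ifP.
  - by move=> i ni; rewrite /f' ni; exact: ffin.
  - by move=> i ni; rewrite /f' ltnNge ni; exists set0.
elim: m {f mf f0 ffin} => [|m IHm] mn f mf f0 ffin find.
  have /choice[A AE] : forall i, exists B : set R, measurable B /\ f i = \1_B.
    by move=> i; have [B mB ->] := find i isT; exists B.
  have mA i : measurable (A i) by have [] := AE i.
  have mXA i : measurable (X i @^-1` A i) by exact: measurable_funPTI.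
  have fE i : f i = \1_(A i) by have [] := AE i.
  under [RHS]eq_bigr do rewrite fE integral_indic_comp//.
  have := indX (iota 0 n) A (iota_uniq _ _) mA.
  rewrite -(big_mkord xpredT (fun i => P (X i @^-1` A i))) /index_iota subn0.
  move <-; rewrite -[in RHS](setIT (\bigcap_(i in _) _)) -integral_indic//; last first.
    by apply: fin_bigcap_measurable => //; exact: finite_set_seq.
  apply: eq_integral => w _; congr (_%:E); rewrite indicE.
  have [wA|] := boolP (w \in _).
    rewrite big1// => i _; rewrite fE indicE mem_set//.
    by move: wA; rewrite inE => wA; apply: wA; rewrite /= mem_iota add0n ltn_ord.
  rewrite notin_setE/= => wA; apply/eqP/prodf_eq0.
  have [i /not_implyP[]] : exists i, ~ ([set` iota 0 n] i -> (X i @^-1` A i) w).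
    exact/existsNP.
  rewrite /= mem_iota add0n => /= ni Xi; exists (Ordinal ni) => //=.
  by rewrite fE indicE memNset.
(* With an indicator put at position [m], the induction hypothesis gives exactly the identity on
   indicators that [weighted_integral_comp] asks for. *)
pose g (A : set R) i := if i == m then \1_A else f i.
have gmE A : g A m = \1_A by rewrite /g eqxx.
have gE A i : i != m -> g A i = f i by rewrite /g => /negPf ->.
pose m' := Ordinal mn.
have IHg (A : set R) (mA : measurable A) :
    \int[P]_w (\prod_(i < n) g A i (X i w))%:E =
    \prod_(i < n) \int[P]_w (g A i (X i w))%:E.
  apply: IHm.
  - exact: ltnW.
  - move=> i; rewrite /g; case: ifP => // _; exact: measurable_indic.
  - by move=> i r; rewrite /g; case: ifP.
  - move=> i im; rewrite /g; case: ifP => _; last exact: ffin.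
    by rewrite integral_indic_comp// (le_lt_trans (probability_le1 _ _)) ?ltry//;
      exact: measurable_funPTI.
  - move=> i mi; rewrite /g; have [_|im] := eqVneq i m; first by exists A.
    by apply: find; rewrite ltn_neqAle eq_sym im.
have prodE (h : nat -> R) :
    (\prod_(i < n) h i = (\prod_(i < n | i != m') h i) * h m)%R.
  by rewrite (bigD1 m')//= mulrC.
(* All factors are finite by [ffin], so [fine] loses nothing. *)
pose C := fine (\prod_(i < n | i != m') \int[P]_w (f i (X i w))%:E).
have CE : C%:E = \prod_(i < n | i != m') \int[P]_w (f i (X i w))%:E.
  rewrite fineK//; apply: prode_fin_num => i _; rewrite ge0_fin_numE ?ffin//.
  by apply: integral_ge0 => w _; rewrite lee_fin.
under eq_integral => w _ do rewrite (prodE (fun i => f i (X i w))).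
rewrite (@weighted_integral_comp _ _ _ P (X m)
  (fun w => \prod_(i < n | i != m') f i (X i w))%R C (f m))//.
- by rewrite [in RHS](bigD1 m')//= muleC CE.
- under eq_fun do rewrite -big_filter.
  by apply: measurable_prod => i _; exact: measurableT_comp.
- by move=> w; exact: prodr_ge0.
- apply: fine_ge0; apply: prode_ge0 => i _.
  by apply: integral_ge0 => w _; rewrite lee_fin.
move=> A mA.
have -> : \int[P]_w (\prod_(i < n | i != m') f i (X i w) * \1_A (X m w))%:E =
    \int[P]_w (\prod_(i < n) g A i (X i w))%:E.
  apply: eq_integral => w _; rewrite (prodE (fun i => g A i (X i w))) gmE.
  by congr ((_ * _)%:E); apply: eq_bigr => i im; rewrite gE.
rewrite IHg// (bigD1 m')//= gmE CE muleC; congr (_ * _).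
  by apply: eq_bigr => i im; rewrite gE.
by rewrite integral_indic_comp.
Qed.

End independence.

(** * Pointwise exponential inequalities *)

Definition lower_tail {R : realType} (c r : R) : R :=
  `|r| * \1_[set s | s <= - c] r.

(** This is exp (h max (r, 0)), split as in conditions (iii) and (iv). *)
Definition exp_majorant {R : realType} (h r : R) : R :=
  \1_[set s | s <= 0] r + expR (h * r) * \1_[set s | 0 < s] r.

Section exp_inequalities.
Context (R : realType).
Implicit Types t x : R.

Lemma ge0_derive_le (f df : R -> R) t : 0 <= t ->
  (forall x, is_derive x 1 f (df x)) -> (forall x, 0 <= x -> 0 <= df x) ->
  f 0 <= f t.
Proof.
move=> t0 fdf df0.
have cf : {within `[0, t], continuous f}.
  apply: continuous_subspaceT => x.
  by apply/differentiable_continuous/derivable1_diffP; case: (fdf x).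
have [c] := MVT_segment t0 (fun x _ => fdf x) cf.
rewrite in_itv/= => /andP[c0 _] /eqP.
by rewrite subr_eq => /eqP ->; rewrite lerDr mulr_ge0 ?df0// subr_ge0.
Qed.

(** The difference of the two sides vanishes at 0 and has derivative exp (- u) - (1 - u), which is
    nonnegative. *)
Lemma expRN_le_quadratic t : 0 <= t -> expR (- t) <= 1 - t + t ^+ 2 / 2.
Proof.
move=> t0.
have := @ge0_derive_le (fun u => 1 - u + u ^+ 2 / 2 - expR (- u))
  (fun u => - 1 + u + expR (- u)) t t0.
rewrite /= oppr0 expR0 => H.
suff : 1 + 0 + 0 ^+ 2 / 2 - 1 <= 1 - t + t ^+ 2 / 2 - expR (- t) by nra.
apply: H.
  move=> x; apply: is_derive_eq.
  rewrite /GRing.scale/=; lra.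
move=> x x0; have := expR_ge1Dx (- x); lra.
Qed.

(** After multiplication by exp (- t) the claim is 1 - t^2 / 2 <= (1 + t) exp (- t). The difference
    vanishes at 0 and has derivative u (1 - exp (- u)) >= 0. *)
Lemma expR_le_quadratic t : 0 <= t -> expR t <= 1 + t + t ^+ 2 / 2 * expR t.
Proof.
move=> t0.
have H : 1 - t ^+ 2 / 2 <= (1 + t) * expR (- t).
  have := @ge0_derive_le (fun u => (1 + u) * expR (- u) - (1 - u ^+ 2 / 2))
    (fun u => u * (1 - expR (- u))) t t0.
  rewrite /= oppr0 expR0 => H.
  suff : (1 + 0) * 1 - (1 - 0 ^+ 2 / 2) <=
    (1 + t) * expR (- t) - (1 - t ^+ 2 / 2) by nra.
  apply: H => x.
    by apply: is_derive_eq; rewrite /GRing.scale/=; lra.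
  by move=> x0; rewrite mulr_ge0// subr_ge0 expR_le1 oppr_le0.
have := ler_wpM2r (expR_ge0 t) H.
have -> : (1 + t) * expR (- t) * expR t = 1 + t.
  by rewrite -mulrA [X in _ * X]mulrC expRxMexpNx_1 mulr1.
lra.
Qed.

(** Squaring exp (t / 4) >= 1 + t / 4 gives exp (t / 2) >= (1 + t / 4)^2 >= t, the last step being
    (1 - t / 4)^2 >= 0; a second squaring concludes. *)
Lemma sqr_le_expR t : 0 <= t -> t ^+ 2 <= expR t.
Proof.
move=> t0.
have tE : t <= expR (t / 2).
  have -> : t / 2 = t / 4 + t / 4 by lra.
  rewrite expRD; apply: (@le_trans _ _ ((1 + t / 4) * (1 + t / 4))).
    by have := sqr_ge0 (1 - t / 4); lra.
  by rewrite ler_pM ?expR_ge1Dx// ler_wpDr// divr_ge0.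
have -> : expR t = expR (t / 2) ^+ 2 by rewrite -expRM_natr divfK.
by rewrite ler_sqr ?nnegrE ?expR_ge0.
Qed.

(** Three ranges of [x]. For x > 0 the quadratic remainder carries an exponential factor, absorbed
    by exp (h x) at the cost 2 / h^2. For x <= - c the left side is at most 1 and the two linear
    terms cancel. For - c < x <= 0 the remainder is at most (y c)^2 / 2, where y = delta h. *)
Lemma expR_le_tails (delta h c x : R) : 0 < delta -> delta <= 1 / 2 -> 0 < h ->
  0 < c ->
  expR (delta * h * x) <= 1 + delta * h * x +
    delta * h * lower_tail c x +
    (delta * h) ^+ 2 * Num.max (c ^+ 2 / 2) (2 / h ^+ 2) * exp_majorant h x.
Proof.
rewrite /lower_tail /exp_majorant.
move=> d0 d2 h0 c0; set M := Num.max _ _.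
have M1 : c ^+ 2 / 2 <= M by rewrite le_max lexx.
have M2 : 2 / h ^+ 2 <= M by rewrite le_max lexx orbT.
have y0 : 0 < delta * h by rewrite mulr_gt0.
set y := delta * h in y0 *.
have [x0|x0] := ltP 0 x.
  rewrite [\1_[set s | s <= - c] x]indicE memNset/=; last first.
    by apply/negP; rewrite -ltNge; lra.
  rewrite [\1_[set s | s <= 0] x]indicE memNset/=; last first.
    by apply/negP; rewrite -ltNge.
  rewrite indicE mem_set//= !mulr0 addr0 add0r mulr1.
  have yx0 : 0 <= y * x by rewrite mulr_ge0 ?ltW.
  apply: (le_trans (expR_le_quadratic yx0)).
  have -> : (y * x) ^+ 2 / 2 * expR (y * x) = y ^+ 2 * (x ^+ 2 / 2 * expR (y * x)).
    by ring.
  rewrite lerD2l -[leRHS]mulrA ler_wpM2l ?sqr_ge0//.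
  apply: (@le_trans _ _ (2 / h ^+ 2 * expR (h * x))); last first.
    by rewrite ler_wpM2r ?expR_ge0.
  have -> : expR (h * x) = expR (h * x - y * x) * expR (y * x).
    by rewrite -expRD subrK.
  rewrite mulrA ler_wpM2r ?expR_ge0//.
  (* Half of the exponent h x absorbs the factor x^2: this is where
     delta <= 1 / 2 is needed. *)
  have hx : (h * x / 2) ^+ 2 <= expR (h * x / 2).
    by rewrite sqr_le_expR ?mulr_ge0 ?ltW.
  have hy : expR (h * x / 2) <= expR (h * x - y * x).
    have : 0 <= (1 / 2 - delta) * (h * x).
      by rewrite mulr_ge0 ?subr_ge0// mulr_ge0 ?ltW.
    by rewrite ler_expR /y; lra.
  (* This identity is the source of the constant 2 / h^2. *)
  have -> : x ^+ 2 / 2 = 2 / h ^+ 2 * (h * x / 2) ^+ 2.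
    by field; rewrite gt_eqF.
  by rewrite ler_wpM2l ?(le_trans hx)// divr_ge0 ?sqr_ge0.
rewrite [\1_[set s | 0 < s] x]indicE memNset/=; last by apply/negP; rewrite -leNgt.
rewrite [\1_[set s | s <= 0] x]indicE mem_set//= mulr0 addr0 mulr1.
have M0 : 0 <= y ^+ 2 * M.
  by rewrite mulr_ge0 ?sqr_ge0// (le_trans _ M1)// divr_ge0 ?sqr_ge0.
have [xc|xc] := leP x (- c).
  rewrite indicE mem_set//= mulr1 ler0_norm// mulrN addrK.
  have : expR (y * x) <= 1 by rewrite expR_le1 mulr_ge0_le0// ltW.
  lra.
rewrite indicE memNset/=; last by apply/negP; rewrite -ltNge.
rewrite !mulr0 addr0.
have := @expRN_le_quadratic (y * - x); rewrite mulrN opprK => H.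
apply: (le_trans (H _)); first by rewrite oppr_ge0 mulr_ge0_le0// ltW.
have -> : (- (y * x)) ^+ 2 / 2 = y ^+ 2 * (x ^+ 2 / 2) by ring.
rewrite lerD2l ler_wpM2l ?sqr_ge0//.
apply: le_trans M1; rewrite ler_pM2r//.
nra.
Qed.

End exp_inequalities.

(** * Integrability and moment bounds for one variable *)

Section one_variable.
Context (d : measure_display) (T : measurableType d) (R : realType).
Context (P : probability T R) (X : {RV P >-> R}).
Implicit Types (h c delta r : R) (f g : T -> R).

Local Notation intg f := (P.-integrable setT (fun w => (f w)%:E)).

Lemma integrable_addE f g : intg f -> intg g -> intg (fun w => f w + g w).
Proof. by move=> intf hg; exact: (integrableD measurableT intf hg). Qed.

Lemma integrable_mulE (k : R) f : intg f -> intg (fun w => k * f w).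
Proof. by move=> intf; exact: (integrableZl measurableT k intf). Qed.

Lemma integrable_cstE (k : R) : intg (fun=> k).
Proof. exact: (finite_measure_integrable_cst P k measurableT). Qed.

Lemma le_integrableE f g : measurable_fun setT f ->
  (forall w, `|f w| <= g w) -> intg g -> intg f.
Proof.
move=> mf fg; apply: le_integrable => //; first exact/measurable_EFinP.
by move=> w _; rewrite lee_fin (le_trans (fg w))// ler_norm.
Qed.

Lemma measurable_lower_tail c : measurable_fun setT (lower_tail c).
Proof.
apply: measurable_funM; first exact: normr_measurable.
apply: measurable_indic.
by rewrite -set_itvNyc.
Qed.

Lemma measurable_exp_majorant h : measurable_fun setT (exp_majorant h).
Proof.
apply: measurable_funD.
  apply: measurable_indic.
  by rewrite -set_itvNyc.
apply: measurable_funM.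
  by apply: measurableT_comp => //; exact: measurable_funM.
apply: measurable_indic.
by rewrite -set_itvoy.
Qed.

Lemma lower_tail_ge0 c r : 0 <= lower_tail c r.
Proof. by rewrite mulr_ge0. Qed.

Lemma exp_majorant_ge0 h r : 0 <= exp_majorant h r.
Proof. by rewrite addr_ge0// mulr_ge0// expR_ge0. Qed.

Lemma exp_majorantE h r : exp_majorant h r = if r <= 0 then 1 else expR (h * r).
Proof.
rewrite /exp_majorant !indicE; have [r0|r0] := leP r 0.
  by rewrite mem_set// memNset/= ?mulr0 ?addr0//; apply/negP; rewrite -leNgt.
by rewrite memNset/= ?mem_set ?mulr1 ?add0r//; apply/negP; rewrite -ltNge.
Qed.

Lemma expR_le_majorant h delta r : 0 < h -> 0 <= delta <= 1 ->
  expR (delta * h * r) <= exp_majorant h r.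
Proof.
move=> h0 /andP[d0 d1]; rewrite exp_majorantE; case: ifPn => [r0|].
  by rewrite expR_le1 mulr_ge0_le0// mulr_ge0// ltW.
by rewrite -ltNge => r0; rewrite ler_expR -mulrA ler_piMl// mulr_ge0// ltW.
Qed.

(** For r > 0 use h r <= exp (h r); between - c and 0 the constant [c] suffices; below - c the tail
    term is |r| itself. Integrability of the variable follows from that of the two tail
    functions. *)
Lemma norm_le_tails h c r : 0 < h -> 0 < c ->
  `|r| <= c + (lower_tail c r + h^-1 * exp_majorant h r).
Proof.
move=> h0 c0; have lt0 := lower_tail_ge0 c r; have em0 := exp_majorant_ge0 h r.
have hem0 : 0 <= h^-1 * exp_majorant h r by rewrite mulr_ge0// invr_ge0 ltW.
have [r0|r0] := ltP 0 r.
  have : h^-1 * (h * r) <= h^-1 * exp_majorant h r.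
    apply: ler_wpM2l; first by rewrite invr_ge0 ltW.
    rewrite exp_majorantE [r <= 0]leNgt r0/=.
    by apply: le_trans (expR_ge1Dx _); rewrite lerDr.
  by rewrite mulKf ?gt_eqF// gtr0_norm//; lra.
have [rc|rc] := leP r (- c).
  have -> : lower_tail c r = `|r| by rewrite /lower_tail indicE mem_set// mulr1.
  lra.
by rewrite ler0_norm//; lra.
Qed.

Lemma integrable_tails h c : 0 < h -> 0 < c ->
  intg (fun w => lower_tail c (X w)) -> intg (fun w => exp_majorant h (X w)) ->
  intg X.
Proof.
move=> h0 c0 intl inte.
apply: (le_integrableE _ (fun w => norm_le_tails (X w) h0 c0)) => //.
apply: integrable_addE; first exact: integrable_cstE.
by apply: integrable_addE => //; exact: integrable_mulE.
Qed.

Lemma integrable_mgf h delta : 0 < h -> 0 <= delta <= 1 ->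
  intg (fun w => exp_majorant h (X w)) ->
  intg (fun w => expR (delta * h * X w)).
Proof.
move=> h0 d01; apply: le_integrableE.
  by apply: measurableT_comp => //; exact: measurable_funM.
by move=> w; rewrite ger0_norm ?expR_ge0 ?expR_le_majorant.
Qed.

Lemma mgf_le_majorant h delta : 0 < h -> 0 <= delta <= 1 ->
  intg (fun w => exp_majorant h (X w)) ->
  \int[P]_w expR (delta * h * X w) <= \int[P]_w exp_majorant h (X w).
Proof.
move=> h0 d01 inte; apply: le_Rintegral => //; first exact: integrable_mgf.
by move=> w _; exact: expR_le_majorant.
Qed.

(** Integration of [expR_le_tails]; integrability of each term permits splitting the integral. *)
Lemma mgf_le_quadratic h c delta : 0 < h -> 0 < c -> 0 < delta -> delta <= 1 / 2 ->
  intg (fun w => lower_tail c (X w)) -> intg (fun w => exp_majorant h (X w)) ->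
  \int[P]_w expR (delta * h * X w) <=
  1 + delta * h * \int[P]_w X w + delta * h * \int[P]_w lower_tail c (X w) +
  (delta * h) ^+ 2 * Num.max (c ^+ 2 / 2) (2 / h ^+ 2) *
    \int[P]_w exp_majorant h (X w).
Proof.
move=> h0 c0 d0 d2 intl inte.
have intX := @integrable_tails _ _ h0 c0 intl inte.
have d01 : 0 <= delta <= 1 by apply/andP; split; lra.
have int1 := @integrable_cstE 1.
have intyX := @integrable_mulE (delta * h) _ intX.
have intyl := @integrable_mulE (delta * h) _ intl.
have intKe := @integrable_mulE
  ((delta * h) ^+ 2 * Num.max (c ^+ 2 / 2) (2 / h ^+ 2)) _ inte.
have int1yX := @integrable_addE _ _ int1 intyX.
have int1yXl := @integrable_addE _ _ int1yX intyl.
apply: (le_trans (y := \int[P]_w (1 + delta * h * X w + delta * h * lower_tail c (X w) +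
  (delta * h) ^+ 2 * Num.max (c ^+ 2 / 2) (2 / h ^+ 2) * exp_majorant h (X w)))).
  apply: le_Rintegral => //; first exact: integrable_mgf.
    exact: integrable_addE.
  by move=> w _; exact: expR_le_tails.
do 3 rewrite RintegralD//.
rewrite !RintegralZl// (Rintegral_cst P measurableT) (_ : fine _ = 1) ?mulr1//.
exact: (congr1 fine (probability_setT P)).
Qed.

End one_variable.

(** * Union bound and Chernoff bound for partial sums *)

Section partial_sums.
Context (d : measure_display) (T : measurableType d) (R : realType).
Context (P : probability T R) (xi : nat -> {RV P >-> R}).

Lemma measurable_partial_sum_gt (x : R) (n : nat) :
  measurable [set w | x < \sum_(i < n) xi i w].
Proof.
pose S : {RV P >-> R} := \sum_(i < n) (xi i : {mfun T >-> R}).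
rewrite (_ : [set w | _] = S @^-1` `]x, +oo[%classic); first exact: measurable_funPTI.
by apply/seteqP; split => w /=; rewrite in_itv/= andbT /S mfun_sum.
Qed.

(** A number strictly below a supremum is strictly below one of the terms; the strict inequality is
    essential here. *)
Lemma sup_partial_sums_gtE (x : R) :
  [set w | (x%:E < sup_partial_sums xi w)%E] =
  \bigcup_n [set w | x < \sum_(i < n) xi i w].
Proof.
apply/seteqP; split => w /=.
  by move/ereal_sup_gt => [_ [n _ <-]]; rewrite lte_fin; exists n.
move=> [n _ /= xS]; apply/ereal_sup_gtP.
by exists (\sum_(i < n) xi i w)%:E; [exists n|rewrite lte_fin].
Qed.

Lemma measurable_sup_partial_sums_gt (x : R) :
  measurable [set w | (x%:E < sup_partial_sums xi w)%E].
Proof.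
rewrite sup_partial_sums_gtE.
by apply: bigcup_measurable => n _; exact: measurable_partial_sum_gt.
Qed.

Lemma sup_partial_sums_le_nneseries (x : R) :
  (P [set w | (x%:E < sup_partial_sums xi w)%E] <=
   \sum_(0 <= n <oo) P [set w | x < \sum_(i < n) xi i w]%R)%E.
Proof.
apply: measure_sigma_subadditive.
- exact: measurable_partial_sum_gt.
- exact: measurable_sup_partial_sums_gt.
- by rewrite sup_partial_sums_gtE.
Qed.

Lemma chernoff_independent_sum (y x : R) (n : nat) :
  mutually_independent xi -> 0 < y ->
  (forall i, (i < n)%N -> P.-integrable setT (fun w => (expR (y * xi i w))%:E)) ->
  (P [set w | x < \sum_(i < n) xi i w]%R <=
   ((\prod_(i < n) \int[P]_w expR (y * xi i w)) * expR (- (y * x)))%R%:E)%E.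
Proof.
move=> indxi y0 intxi.
pose S : {RV P >-> R} := \sum_(i < n) (xi i : {mfun T >-> R}).
have SE w : S w = \sum_(i < n) xi i w by rewrite /S mfun_sum.
have mS : measurable [set w | x <= S w].
  rewrite (_ : [set w | _] = S @^-1` (`[x, +oo[)%classic); first exact: measurable_funPTI.
  by apply/seteqP; split => w /=; rewrite in_itv/= andbT.
(* [chernoff] bounds the closed event, which contains the strict one. *)
apply: (@le_trans _ _ (P [set w | x <= S w])).
  apply: le_measure; rewrite ?inE//; first exact: measurable_partial_sum_gt.
  by move=> w /= /ltW; rewrite SE.
apply: (le_trans (chernoff _ _ y0)); rewrite EFinM lee_wpmul2r ?lee_fin ?expR_ge0//.
rewrite /mmt_gen_fun unlock.
have -> : (\int[P]_w ((expR \o y \o* S) w)%:E =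
    \int[P]_w (\prod_(i < n) expR (y * xi i w))%:E)%E.
  apply: eq_integral => w _; rewrite /= SE mulr_suml expR_sum.
  by under eq_bigr do rewrite mulrC.
rewrite (@independent_integral_prod _ _ _ P xi n (fun _ r => expR (y * r)))//.
- rewrite -prodEFin le_eqVlt; apply/orP; left; apply/eqP/eq_bigr => i _.
  by rewrite /Rintegral fineK//; apply: integrable_fin_num => //; exact: intxi.
- by move=> i; apply: measurableT_comp => //; exact: measurable_funM.
- by move=> i ni; apply: integrable_lty => //; exact: intxi.
Qed.

End partial_sums.

(** * Averages, products and geometric sums *)

(** One infinite term among nonnegative ones would make the mean infinite. This turns the
    extended-real conditions into finiteness of each term and a real inequality. *)
Lemma mean_le_fine (R : realType) (u : nat -> \bar R) (D : R) (n : nat) :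
  (0 < n)%N -> (forall i, 0 <= u i)%E ->
  ((n%:R^-1)%:E * \sum_(i < n) u i <= D%:E)%E ->
  (forall i, (i < n)%N -> u i < +oo)%E /\ (\sum_(i < n) fine (u i)) / n%:R <= D.
Proof.
move=> n0 u0 uD.
have nR : 0 < n%:R^-1 :> R by rewrite invr_gt0 ltr0n.
have ufin i : (i < n)%N -> (u i < +oo)%E.
  move=> ni; rewrite ltey; apply/negP => /eqP uoo.
  move: uD; rewrite (_ : (\sum_(i < n) u i)%E = +oo%E).
    by rewrite gt0_muley ?lte_fin// leye_eq.
  apply/eqP; rewrite esum_eqy; last first.
    by move=> j _; rewrite gt_eqF// (lt_le_trans _ (u0 _)).
  by apply/existsP; exists (Ordinal ni); rewrite /= uoo eqxx.
split=> //; move: uD.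
under eq_bigr do rewrite -[u _]fineK ?ge0_fin_numE ?ufin//.
by rewrite sumEFin -EFinM lee_fin mulrC.
Qed.

Lemma AGM_ord (R : realFieldType) (n : nat) (m : nat -> R) (D : R) :
  (forall i, 0 <= m i) -> (0 < n)%N -> (\sum_(i < n) m i) / n%:R <= D ->
  \prod_(i < n) m i <= D ^+ n.
Proof.
move=> m0 n0 mD.
have [+ _] := @leif_AGM R 'I_n xpredT (fun i => m i) (fun i _ => m0 i).
rewrite card_ord => /le_trans; apply; rewrite lerXn2r// nnegrE.
- by rewrite divr_ge0// sumr_ge0.
- by apply: le_trans mD; rewrite divr_ge0// sumr_ge0.
Qed.

Lemma sum_expr_le (R : realFieldType) (q : R) n : 0 <= q -> q < 1 ->
  \sum_(i < n) q ^+ i <= (1 - q)^-1.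
Proof.
move=> q0 q1; have q1' : 0 < 1 - q by rewrite subr_gt0.
rewrite -[leRHS]mulr1 ler_pdivlMl//.
have -> : (1 - q) * \sum_(i < n) q ^+ i = 1 - q ^+ n.
  by rewrite -opprB mulNr -subrX1 opprB.
by rewrite gerBl exprn_ge0.
Qed.

Lemma geom_constE (R : realType) (b : nat) (d2 : R) : 1 <= d2 ->
  geom_const b d2 = \sum_(1 <= k < b) d2 ^+ k.
Proof.
move=> d2_ge1; rewrite big_add1 big_mkord -subn1 /geom_const.
under [RHS]eq_bigr do rewrite exprS.
rewrite -mulr_sumr; case: ifPn => [d2_gt1|].
  by rewrite subrX1 mulrAC mulfV ?mul1r// subr_eq0 gt_eqF.
rewrite -leNgt => d2_le1; have -> : d2 = 1 by apply/le_anti/andP.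
by rewrite mul1r; under eq_bigr do rewrite expr1n; rewrite sumr_const card_ord.
Qed.

Lemma head_tail_sum_le (R : realType) (b N : nat) (d2 q : R) (v : nat -> R) :
  1 <= d2 -> 0 <= q -> q < 1 -> v 0%N = 0 -> (0 < b)%N -> (forall n, 0 <= v n) ->
  (forall n, (0 < n < b)%N -> v n <= d2 ^+ n) ->
  (forall n, (b <= n)%N -> v n <= q ^+ n) ->
  \sum_(0 <= n < N) v n <= geom_const b d2 + q ^+ b / (1 - q).
Proof.
move=> d2_ge1 q0 q1 v00 b0 v0 vhead vtail.
(* Lengthening the sum to [b + N] terms only increases it, and allows a split at [b] even when
   [N < b]. *)
apply: (@le_trans _ _ (\sum_(0 <= n < b + N) v n)).
  rewrite (@big_cat_nat _ _ _ N _ (b + N))//= ?leq_addl// lerDl.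
  by rewrite sumr_ge0.
rewrite (@big_cat_nat _ _ _ b _ (b + N))//= ?leq_addr//.
rewrite big_ltn// v00 add0r lerD//.
  by rewrite geom_constE// !big_nat; apply: ler_sum => n /vhead.
apply: (@le_trans _ _ (\sum_(b <= n < b + N) q ^+ n)).
  by rewrite !big_nat; apply: ler_sum => n /andP[/vtail].
rewrite -{1}[b]add0n big_addn addKn big_mkord.
under eq_bigr do rewrite addnC exprD.
by rewrite -mulr_sumr ler_wpM2l ?exprn_ge0// sum_expr_le.
Qed.

(** * Conditions (ii) to (iv) as integrals of the tail functions *)

Lemma expectation_lower_tail (d : measure_display) (T : measurableType d)
    (R : realType) (P : probability T R) (X : {RV P >-> R}) (c : R) :
  ('E_P[fun w => `|X w| * \1_[set w' | X w' <= - c] w]%R =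
  \int[P]_w (lower_tail c (X w))%:E)%E.
Proof. by rewrite unlock. Qed.

Lemma expectation_exp_majorant (d : measure_display) (T : measurableType d)
    (R : realType) (P : probability T R) (X : {RV P >-> R}) (h : R) :
  (P [set w | X w <= 0]%R +
     'E_P[fun w => expR (h * X w) * \1_[set w' | 0 < X w'] w]%R)%E =
  (\int[P]_w (exp_majorant h (X w))%:E)%E.
Proof.
have m1 : measurable [set s : R | s <= 0] by rewrite -set_itvNyc.
have m2 : measurable [set s : R | 0 < s] by rewrite -set_itvoy.
rewrite unlock -(integral_indic_comp P X m1).
rewrite -ge0_integralD//.
- by apply/measurable_EFinP/measurableT_comp => //; exact: measurable_indic.
- apply/measurable_EFinP/measurable_funM.
    by apply: measurableT_comp => //; exact: measurable_funM.
  by apply: measurable_indic; exact: (measurable_funPTI X m2).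
Qed.

Lemma integrable_ge0_comp (d : measure_display) (T : measurableType d)
    (R : realType) (P : probability T R) (X : {RV P >-> R}) (f : R -> R) :
  measurable_fun setT f -> (forall r, 0 <= f r) ->
  (\int[P]_w (f (X w))%:E < +oo)%E -> P.-integrable setT (fun w => (f (X w))%:E).
Proof.
move=> mf f0 foo; apply/integrableP; split.
  by apply/measurable_EFinP; exact: measurableT_comp.
by under eq_integral do rewrite gee0_abs ?lee_fin//.
Qed.

(** * The tail bound for the supremum *)

Unset Implicit Arguments.

Theorem theorem3 (d : measure_display) (T : measurableType d) (R : realType)
    (P : probability T R) (xi : nat -> {RV P >-> R})
    (a : R) (b : nat) (c eps h d1 d2 : R)
    (xi_indep : mutually_independent xi)
    (a_gt0 : 0 < a) (b_gt0 : (0 < b)%N) (c_gt0 : 0 < c) (eps_ge0 : 0 <= eps)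
    (h_gt0 : 0 < h) (d1_ge1 : 1 <= d1) (d2_ge1 : 1 <= d2)
    (cond_i : forall n : nat, (b <= n)%N ->
       (mean_expectation xi n <= (- a)%:E)%E)
    (cond_ii : (ereal_sup [set mean_lower_tail xi c n | n in [set n : nat | (b <= n)%N]]
       <= eps%:E)%E)
    (cond_iii : (ereal_sup [set mean_exp_moment xi h n | n in [set n : nat | (b <= n)%N]]
       <= d1%:E)%E)
    (cond_iv : forall n : nat, (1 <= n <= b - 1)%N ->
       (mean_exp_moment xi h n <= d2%:E)%E)
    (delta Delta : R) (delta_gt0 : 0 < delta) (delta_le : delta <= 1 / 2)
    (Delta_def : - Delta =
       eps + delta * h * d1 * Num.max (c ^+ 2 / 2) (2 / h ^+ 2) - a)
    (Delta_neg : - Delta < 0) :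
  let c1 := geom_const b d2 +
    expR (- (delta * h * Delta * b%:R)) / (1 - expR (- (delta * h * Delta))) in
  forall x : R, 0 <= x ->
    (P [set w | (x%:E < sup_partial_sums xi w)%E]
       <= (Num.min 1 (c1 * expR (- (delta * h * x))))%:E)%E.
Proof.
move=> c1 x x0.
pose y := delta * h; pose M := Num.max (c ^+ 2 / 2) (2 / h ^+ 2).
have y0 : 0 < y by rewrite mulr_gt0.
have d01 : 0 <= delta <= 1 by apply/andP; split; lra.
have M0 : 0 <= M by rewrite le_max divr_ge0 ?sqr_ge0.
(* Real-valued integrals take the value 0 when the extended one is infinite; [intl], [inte], [intX]
   and [intm] below exclude this. *)
pose l i : R := \int[P]_w lower_tail c (xi i w).
pose e i : R := \int[P]_w exp_majorant h (xi i w).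
pose ex i : R := \int[P]_w xi i w.
pose m i : R := \int[P]_w expR (delta * h * xi i w).
have l_mean n : (b <= n)%N ->
    (forall i, (i < n)%N -> \int[P]_w (lower_tail c (xi i w))%:E < +oo)%E /\
    (\sum_(i < n) l i) / n%:R <= eps.
  move=> bn; have n0 := leq_trans b_gt0 bn.
  apply: (mean_le_fine (u := fun i => \int[P]_w (lower_tail c (xi i w))%:E)%E) => //.
    by move=> i; apply: integral_ge0 => w _; rewrite lee_fin lower_tail_ge0.
  under eq_bigr do rewrite -expectation_lower_tail.
  by apply: le_trans cond_ii; apply: ereal_sup_ubound; exists n.
have e_mean n D : (0 < n)%N -> (mean_exp_moment xi h n <= D%:E)%E ->
    (forall i, (i < n)%N -> \int[P]_w (exp_majorant h (xi i w))%:E < +oo)%E /\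
    (\sum_(i < n) e i) / n%:R <= D.
  move=> n0 nD.
  apply: (mean_le_fine (u := fun i => \int[P]_w (exp_majorant h (xi i w))%:E)%E) => //.
    by move=> i; apply: integral_ge0 => w _; rewrite lee_fin exp_majorant_ge0.
  by under eq_bigr do rewrite -expectation_exp_majorant.
have e_mean1 n : (b <= n)%N ->
    (forall i, (i < n)%N -> \int[P]_w (exp_majorant h (xi i w))%:E < +oo)%E /\
    (\sum_(i < n) e i) / n%:R <= d1.
  move=> bn; apply: e_mean; first exact: leq_trans bn.
  by apply: le_trans cond_iii; apply: ereal_sup_ubound; exists n.
(* The mean over the first [b + i.+1] variables is covered by the condition and includes index [i],
   whence integrability for every [i]. *)
have intl i : P.-integrable setT (fun w => (lower_tail c (xi i w))%:E).
  apply: integrable_ge0_comp; [exact: measurable_lower_tail|exact: lower_tail_ge0|].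
  by have [+ _] := l_mean _ (leq_addr i.+1 b); apply; rewrite addnS ltnS leq_addl.
have inte i : P.-integrable setT (fun w => (exp_majorant h (xi i w))%:E).
  apply: integrable_ge0_comp; [exact: measurable_exp_majorant|exact: exp_majorant_ge0|].
  by have [+ _] := e_mean1 _ (leq_addr i.+1 b); apply; rewrite addnS ltnS leq_addl.
have intX i : P.-integrable setT (fun w => (xi i w)%:E).
  exact: (integrable_tails h_gt0 c_gt0 (intl i) (inte i)).
have intm i : P.-integrable setT (fun w => (expR (delta * h * xi i w))%:E).
  exact: (integrable_mgf h_gt0 d01 (inte i)).
have ex_mean n : (b <= n)%N -> (\sum_(i < n) ex i) / n%:R <= - a.
  move=> bn; have := cond_i n bn; rewrite /mean_expectation.
  have exE i : ('E_P[xi i] = (ex i)%:E)%E.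
    by rewrite unlock /ex /Rintegral fineK//; exact: integrable_fin_num.
  by under eq_bigr do rewrite exE; rewrite sumEFin -EFinM lee_fin mulrC.
have m0 i : 0 <= m i by apply: Rintegral_ge0 => w _; exact: expR_ge0.
pose q := expR (- (delta * h * Delta)).
have Delta0 : 0 < Delta by lra.
have q0 : 0 <= q by exact: expR_ge0.
have q1 : q < 1 by rewrite expR_lt1 oppr_lt0 mulr_gt0.
have prod_head n : (0 < n < b)%N -> \prod_(i < n) m i <= d2 ^+ n.
  move=> /andP[n0 nb]; apply: AGM_ord => //.
  have /(e_mean _ _ n0)[_] : (mean_exp_moment xi h n <= d2%:E)%E.
    by apply: cond_iv; rewrite n0 leq_subRL// add1n.
  apply: le_trans; rewrite ler_wpM2r ?invr_ge0//; apply: ler_sum => i _.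
  exact: (mgf_le_majorant h_gt0 d01 (inte i)).
have prod_tail n : (b <= n)%N -> \prod_(i < n) m i <= q ^+ n.
  move=> bn; have n0 := leq_trans b_gt0 bn.
  apply: AGM_ord => //; apply: le_trans (expR_ge1Dx _).
  have nR : 0 < n%:R :> R by rewrite ltr0n.
  have step : \sum_(i < n) m i <=
      \sum_(i < n) (1 + y * ex i + y * l i + y ^+ 2 * M * e i).
    apply: ler_sum => i _.
    exact: (mgf_le_quadratic h_gt0 c_gt0 delta_gt0 delta_le (intl i) (inte i)).
  (* Expanding [Delta] leaves one term for each of conditions (i), (ii) and (iii), to be compared
     separately with the averaged quadratic bound. *)
  have -> : 1 + - (delta * h * Delta) = 1 + y * - a + y * eps + y ^+ 2 * M * d1.
    have -> : Delta = - (eps + delta * h * d1 * M - a) by rewrite -Delta_def opprK.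
    by rewrite /y; ring.
  apply: le_trans (_ : _ <= 1 + y * ((\sum_(i < n) ex i) / n%:R) +
    y * ((\sum_(i < n) l i) / n%:R) + y ^+ 2 * M * ((\sum_(i < n) e i) / n%:R)) _.
    rewrite ler_pdivrMr//; apply: (le_trans step).
    rewrite !big_split/= -!mulr_sumr sumr_const card_ord.
    rewrite le_eqVlt; apply/orP; left; apply/eqP; field.
    by rewrite gt_eqF.
  apply: lerD; first apply: lerD; first apply: lerD => //.
  - by rewrite ler_wpM2l ?ex_mean// ltW.
  - by rewrite ler_wpM2l ?(l_mean _ bn).2// ltW.
  - by rewrite ler_wpM2l ?(e_mean1 _ bn).2// mulr_ge0 ?sqr_ge0.
rewrite EFin_min le_min; apply/andP; split.
  exact/probability_le1/measurable_sup_partial_sums_gt.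
apply: (le_trans (sup_partial_sums_le_nneseries xi x)).
(* The empty product would contribute 1 at n = 0; the value 0 is correct because the empty sum never
   exceeds x >= 0. *)
pose v n : R := if n is 0 then 0 else \prod_(i < n) m i.
apply: lime_le.
  by apply: is_cvg_nneseries => n _ _; exact: measure_ge0.
apply: nearW => N.
apply: (@le_trans _ _ (\sum_(0 <= n < N) (v n * expR (- (delta * h * x)))%:E)%E).
  apply: lee_sum => -[|n] _.
    by rewrite (_ : [set w | _] = set0) ?measure0 ?mul0r//; apply/seteqP; split => w //=;
      rewrite big_ord0 ltNge x0.
  by apply: chernoff_independent_sum.
rewrite sumEFin lee_fin -mulr_suml ler_wpM2r ?expR_ge0//.
(* The numerator in [c1] becomes [q ^+ b], the first term of the geometric tail. *)
rewrite /c1 -mulNr expRM_natr.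
apply: head_tail_sum_le => //.
- by case=> //= n; exact: prodr_ge0.
- by case=> // n /prod_head.
- by case=> [|n /prod_tail//]; rewrite leqNgt b_gt0.
Qed.
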